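(* (i) There is an absolute constant $c>0$ such that for each $n\in\mathbb{N}$ and each integer $t>n$ there is a probability distribution on $[n]=\{1,\ldots,n\}$ for which $$\mathbb{E}[U_t]\ge c\,\frac{n-1}{t}.$$ (ii) There is an absolute constant $c>0$ such that for each integer $a>1$ there is a probability distribution $P$ over $S=\mathbb{N}$ such that $\ell(P)=a$ and $$\mathbb{E}[U_t]\ge c\,\frac{a}{t}\qquad\text{for all integers } t>a.$$
   Context: Let $S$ be a countable set with a probability measure $P$, and write $p_s=P(\{s\})$. Let $X_1,\ldots,X_t$ be drawn independently from $S$ according to $P$. The missing mass is the random variable $U_t=P(S\setminus\{X_1,\ldots,X_t\})$; its expectation is $\mathbb{E}[U_t]=\sum_{s\in S}p_s(1-p_s)^t$. For a probability distribution $P$ over $\mathbb{N}=\{1,2,\ldots\}$ with $p_i=P(\{i\})$, the plateau length is $$\ell(P)=\sup_{0<\alpha<1}\bigl|\{i\in\mathbb{N}:\alpha/2\le p_i<\alpha\}\bigr|,$$ which may equal $\infty$. *)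

(* Defs.v *)
From HB Require Import structures.
From mathcomp Require Import all_boot all_order all_algebra.
From mathcomp Require Import all_classical all_reals all_analysis.

Set Implicit Arguments.
Unset Strict Implicit.
Unset Printing Implicit Defensive.

Import Order.TTheory GRing.Theory Num.Theory.

Local Open Scope classical_set_scope.
Local Open Scope ring_scope.

(* The sets {1, 2, ...} and {1, ..., n} are subsets of [nat], which carries the
   discrete sigma-algebra. *)
Definition Nplus : set nat := [set i | (0 < i)%N].
Definition initial_segment (n : nat) : set nat := [set i | (0 < i <= n)%N].

Definition distribution_on (R : realType) (S : set nat) (P : probability nat R) :=
  P S = 1%E.

(* The joint law of the whole finite family factorizes; subfamilies are covered
   by taking [A i = setT] for the omitted indices. *)
Definition mutually_independent (d d' : measure_display)
    (Omega : measurableType d) (T : measurableType d') (R : realType)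
    (Pr : probability Omega R) (t : nat) (X : 'I_t -> {RV Pr >-> T}) :=
  forall A : 'I_t -> set T, (forall i, measurable (A i)) ->
    Pr (\bigcap_i (X i @^-1` A i)) = (\prod_(i < t) Pr (X i @^-1` A i))%E.

Definition iid_sample (d d' : measure_display)
    (Omega : measurableType d) (T : measurableType d') (R : realType)
    (Pr : probability Omega R) (P : probability T R) (t : nat)
    (X : 'I_t -> {RV Pr >-> T}) :=
  mutually_independent X /\
  forall i (A : set T), measurable A -> distribution Pr (X i) A = P A.

(* Statements quantified over all i.i.d. samples from [P] are not vacuous. *)
Lemma iid_sample_exists (d' : measure_display) (T : measurableType d')
    (R : realType) (P : probability T R) (t : nat) :
  exists (d : measure_display) (Omega : measurableType d)
    (Pr : probability Omega R) (X : 'I_t -> {RV Pr >-> T}), iid_sample P X.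
Proof.
elim: t => [|t [d [ Omega [Pr [X [indX lawX]]]]]].
  exists d', T, P, (fun i : 'I_0 => False_rect _ (notF (ltn_ord i))).
  split; [move=> A _ | by case].
  by rewrite big_ord0 (_ : \bigcap_i _ = setT) ?probability_setT//;
    apply/seteqP; split=> // x _ [].
have [Pr' PrE] : exists Pr' : probability (Omega * T)%type R,
    forall A B, measurable A -> measurable B -> Pr' (A `*` B) = (Pr A * P B)%E.
  by exists (Pr \x P)%E => A B mA mB; exact: product_measure1E.
have [Y [Y0 YS]] : exists Y : 'I_t.+1 -> {RV Pr' >-> T},
    (forall x, Y ord0 x = x.2) /\ forall j x, Y (lift ord0 j) x = X j x.1.
  pose X' (i : 'I_t.+1) : Omega * T -> T :=
    if unlift ord0 i is Some j then X j \o fst else snd.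
  have mX' i : measurable_fun setT (X' i).
    by rewrite /X'; case: unlift => [j|];
      [exact: measurableT_comp|exact: measurable_snd].
  exists (fun i => HB.pack_for {mfun (Omega * T)%type >-> T} (X' i)
    (isMeasurableFun.Build _ _ _ _ _ (mX' i))).
  by split=> [x|j x] /=; rewrite /X' ?unlift_none ?liftK.
have Y0E A : Y ord0 @^-1` A = setT `*` A.
  by apply/seteqP; split=> x; rewrite /preimage/= Y0//; case.
have YSE j A : Y (lift ord0 j) @^-1` A = (X j @^-1` A) `*` setT.
  by apply/seteqP; split=> x; rewrite /preimage/= YS//; case.
have PrY0 A : measurable A -> Pr' (Y ord0 @^-1` A) = P A.
  by move=> mA; rewrite Y0E PrE// probability_setT mul1e.
have PrYS j A : measurable A -> Pr' (Y (lift ord0 j) @^-1` A) = Pr (X j @^-1` A).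
  move=> mA; rewrite YSE PrE ?probability_setT ?mule1//.
  exact: measurable_funPTI.
exists _, (Omega * T)%type, Pr', Y; split=> [A mA|i A mA]; last first.
  rewrite /distribution /pushforward /=.
  by case: (unliftP ord0 i) => [j|] ->; [rewrite PrYS//; exact: lawX|rewrite PrY0].
rewrite big_ord_recl PrY0//.
under eq_bigr do rewrite PrYS//.
rewrite -(indX (fun j => A (lift ord0 j)))//.
rewrite (_ : \bigcap_i _ =
    (\bigcap_j (X j @^-1` A (lift ord0 j))) `*` A ord0); last first.
  apply/seteqP; split=> x.
    move=> Ax; split.
      by move=> j _; have := Ax (lift ord0 j) I; rewrite YSE => -[].
    by have := Ax ord0 I; rewrite Y0E => -[].
  move=> [Ax Ax0] i _; case: (unliftP ord0 i) => [j|] ->.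
    by rewrite YSE; split=> //; exact: Ax.
  by rewrite Y0E.
rewrite PrE; [by rewrite muleC| |exact: mA].
apply: fin_bigcap_measurable => [|j _]; first exact: finite_finset.
by apply: measurable_funPTI; exact: mA.
Qed.

Definition missing_mass (d : measure_display) (Omega : measurableType d)
    (R : realType) (Pr : probability Omega R) (S : set nat)
    (P : probability nat R) (t : nat) (X : 'I_t -> {RV Pr >-> nat})
    (w : Omega) : R :=
  fine (P (S `\` range (fun i => X i w))).

(* [counting] is [+oo] on infinite sets, so the plateau length may be [+oo]. *)
Definition plateau_length (R : realType) (P : probability nat R) : \bar R :=
  ereal_sup
    [set counting [set i | Nplus i /\ ((alpha / 2)%:E <= P [set i] < alpha%:E)%E]
      | alpha in `]0%R, 1%R[].

(* Main.v *)
(* An atom of mass p is missed by the whole sample with probability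
   (1 - p)^t, which is at least 1/2 once t * p <= 1/2 (Bernoulli), so m such
   atoms of equal mass contribute at least m * p / 2 to the expected missing
   mass. For (i), give the points 1, ..., n - 1 mass 1 / (2 t). For (ii), put
   a atoms of mass 2^-(k+1) / a at every level k: a window [alpha / 2, alpha)
   meets at most one level, and every t > a has a level whose mass lies between
   1 / (4 t) and 1 / (2 t). *)
Require Import Defs.
From HB Require Import structures.
From mathcomp Require Import all_boot all_order all_algebra.
From mathcomp Require Import finmap.
From mathcomp Require Import all_classical all_reals all_analysis.
From mathcomp Require Import measurable_realfun.
From mathcomp Require Import ring lra.

Set Implicit Arguments.
Unset Strict Implicit.
Unset Printing Implicit Defensive.

Import Order.TTheory GRing.Theory Num.Theory.

Local Open Scope classical_set_scope.
Local Open Scope ring_scope.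

(** * Expected missing mass carried by equal atoms *)

Lemma bernoulli_ineq (R : realDomainType) (x : R) (n : nat) :
  x <= 1 -> 1 - n%:R * x <= (1 - x) ^+ n.
Proof.
move=> x1; elim: n => [|n IH]; first by rewrite mul0r subr0 expr0.
rewrite exprS; apply: le_trans (ler_wpM2l _ IH); last by rewrite subr_ge0.
have := mulr_ge0 (ler0n R n) (sqr_ge0 x).
by rewrite -natr1; nra.
Qed.

(* Unlike [ge0_le_integral], no measurability: the integral of a nonnegative
   function is a supremum over the simple functions below it. *)
Lemma ge0_le_integral_nonmeasurable (d : measure_display)
    (T : measurableType d) (R : realType) (mu : {measure set T -> \bar R})
    (f g : T -> \bar R) :
  (forall x, 0 <= f x)%E -> (forall x, f x <= g x)%E ->
  (\int[mu]_x f x <= \int[mu]_x g x)%E.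
Proof.
move=> f0 fg.
have g0 x : (0 <= g x)%E by exact: le_trans (f0 x) (fg x).
rewrite !ge0_integralTE//; apply: ge_ereal_sup => _ [h hf <-].
apply: ereal_sup_ubound; exists h => // x.
exact: le_trans (hf x) (fg x).
Qed.

(** By independence the sample avoids a given atom with probability [(1 - p) ^+ t]. The missing mass
    dominates [p] times the number of avoided atoms, and linearity of the integral gives the
    bound. *)
Lemma le_expectation_missing_mass (d : measure_display)
    (Omega : measurableType d) (R : realType) (Pr : probability Omega R)
    (S : set nat) (P : probability nat R) (t : nat)
    (X : 'I_t -> {RV Pr >-> nat}) (m : nat) (f : 'I_m -> nat) (p : R) :
  iid_sample P X -> injective f -> (forall k, S (f k)) ->
  (forall k, P [set f k] = p%:E) ->
  ((m%:R * (p * (1 - p) ^+ t))%:E <= 'E_Pr[missing_mass S P X])%E.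
Proof.
move=> [indX lawX] injf Sf Pf.
pose B k := \bigcap_(i : 'I_t) (X i @^-1` ~` [set f k]).
have mXC i k : measurable (X i @^-1` ~` [set f k]).
  by apply: measurable_funPTI.
have mB k : measurable (B k).
  by apply: fin_bigcap_measurable => //; exact: finite_finset.
have PrB k : Pr (B k) = ((1 - p) ^+ t)%:E.
  rewrite /B indX//.
  under eq_bigr do rewrite [Pr _]lawX// probability_setC// Pf -EFinB.
  by rewrite prodEFin prodr_const card_ord.
(* The sign of [p] is read off an atom of that mass, hence the index [k]: for [m = 0] nothing
   constrains [p]. *)
have p0 (k : 'I_m) : (0 <= p)%R by rewrite -lee_fin -(Pf k) measure_ge0.
apply: (@le_trans _ _ (\int[Pr]_w \sum_(k < m) (p%:E * (\1_(B k) w)%:E))%E).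
  rewrite ge0_integral_sum//=; last 2 first.
  - move=> k; apply: measurable_funeM; apply/measurable_EFinP.
    exact: measurable_indic.
  - by move=> k x _; rewrite mule_ge0// lee_fin ?p0.
  rewrite (eq_bigr (fun=> (p * (1 - p) ^+ t)%:E)); last first.
    move=> k _; rewrite ge0_integralZl_EFin ?(p0 k)//; last first.
      by apply/measurable_EFinP; exact: measurable_indic.
    by rewrite integral_indic// setIT EFinM -(PrB k).
  by rewrite sumEFin sumr_const card_ord mulr_natl.
rewrite expectation.unlock; apply: ge0_le_integral_nonmeasurable => w.
  by apply: sume_ge0 => k _; rewrite mule_ge0// lee_fin ?p0.
rewrite /missing_mass fineK ?fin_num_measure//.
pose D := S `\` range (X^~ w).
(* Cutting each atom down to the unseen set [D] yields disjoint subsets of [D] for every [w]. A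
   piece keeps mass [p] when [w] is in [B k]; otherwise nonnegativity suffices. *)
apply: (@le_trans _ _ (P (\big[setU/set0]_(k < m) ([set f k] `&` D)))%E);
  last first.
  apply: le_measure; rewrite ?inE//.
  by apply: (big_ind (fun A => A `<=` D)) => [|A A'|k _] //; rewrite subUset.
rewrite measure_bigsetU_ord//; last first.
  by apply/trivIsetP => j k _ _ /eqP jk; apply/seteqP; split => // x
    [[-> _] [/injf]].
apply: lee_sum => k _; rewrite indicE.
have [|] := boolP (w \in B k); rewrite ?mule1 ?mule0 ?measure_ge0//.
rewrite inE => Bw; rewrite -(Pf k) setIidl// => _ ->; split=> // -[i _].
exact: (Bw i).
Qed.
Lemma le_expectation_missing_mass_half (d : measure_display)
    (Omega : measurableType d) (R : realType) (Pr : probability Omega R)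
    (S : set nat) (P : probability nat R) (t : nat)
    (X : 'I_t -> {RV Pr >-> nat}) (m : nat) (f : 'I_m -> nat) (p : R) :
  iid_sample P X -> injective f -> (forall k, S (f k)) ->
  (forall k, P [set f k] = p%:E) -> 0 <= p <= 1 -> t%:R * p <= 2^-1 ->
  ((m%:R * p / 2)%:E <= 'E_Pr[missing_mass S P X])%E.
Proof.
move=> iidX injf Sf Pf /andP[p0 p1] tp.
apply: le_trans (le_expectation_missing_mass iidX injf Sf Pf).
rewrite lee_fin -mulrA ler_wpM2l// ler_wpM2l//.
by have := bernoulli_ineq t p1; lra.
Qed.

(** * Finite blocks of atoms and part (i) *)

(* The unused proof of total mass makes the probability structure inferable. *)
Definition probability_of_measure (d : measure_display) (T : measurableType d)
    (R : realType) (mu : {measure set T -> \bar R}) (mu1 : mu setT = 1%E) :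
    set T -> \bar R := mu.

HB.instance Definition _ (d : measure_display) (T : measurableType d)
    (R : realType) (mu : {measure set T -> \bar R}) (mu1 : mu setT = 1%E) :=
  Measure.copy (probability_of_measure mu1) mu.

HB.instance Definition _ (d : measure_display) (T : measurableType d)
    (R : realType) (mu : {measure set T -> \bar R}) (mu1 : mu setT = 1%E) :=
  Measure_isProbability.Build _ _ _ (probability_of_measure mu1) mu1.

(** The successor keeps every atom off [0], so offset [0] starts at the point [1]. Both
    distributions are weighted sums of such blocks. *)
Definition counting_block (R : realType) (b m : nat) :
    {measure set nat -> \bar R} :=
  msum (fun j => @dirac _ nat (b + j).+1 R) m.

Lemma counting_block_sub (R : realType) (b m : nat) (A : set nat) :
  (forall j, (j < m)%N -> A (b + j).+1) ->
  counting_block R b m A = m%:R%:E.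
Proof.
move=> bA; rewrite /counting_block/= /msum.
rewrite (eq_bigr (fun=> 1%E)) => [|j _]; last first.
  by rewrite [LHS]diracE mem_set//; exact: bA.
by rewrite sumEFin sumr_const card_ord.
Qed.

Lemma counting_block_set1 (R : realType) (b m i : nat) :
  counting_block R b m [set i] = (b < i <= b + m)%N%:R%:E.
Proof.
rewrite /counting_block/= /msum.
have [/andP[bi im]|ibm] := boolP (b < i <= b + m)%N; last first.
  rewrite big1// => j _; rewrite [LHS]diracE memNset// => /= ji.
  by move: ibm; rewrite -ji ltnS leq_addr/= -addnS leq_add2l ltn_ord.
have jm : (i - b.+1 < m)%N by rewrite ltn_subLR// addSn ltnS.
rewrite (bigD1 (Ordinal jm))//= big1 => [|j]; last first.
  rewrite -val_eqE/= => /eqP ji; rewrite [LHS]diracE memNset// => /= eqi.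
  by apply: ji; rewrite -eqi subSS addKn.
by rewrite adde0 [LHS]diracE mem_set//= -addSn subnKC.
Qed.
(** The point [n] absorbs the mass [1 - (n - 1) * p] left over by the equal atoms, which the bound
    on [(n - 1) * p] makes nonnegative. *)
Lemma near_uniform_distribution (R : realType) (n : nat) (p : R) :
  (0 < n)%N -> 0 <= p -> (n%:R - 1) * p <= 1 ->
  exists P : probability nat R, distribution_on (initial_segment n) P /\
    forall i, (0 < i < n)%N -> P [set i] = p%:E.
Proof.
case: n => // n _ p0; rewrite -natr1 addrK => np1.
have q0 : 0 <= 1 - n%:R * p by rewrite subr_ge0.
pose mu : {measure set nat -> \bar R} := measure_add
  (mscale (NngNum p0) (counting_block R 0 n))
  (mscale (NngNum q0) (counting_block R n 1)).
have muE A : mu A = (p%:E * counting_block R 0 n A +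
    (1 - n%:R * p)%:E * counting_block R n 1 A)%E by exact: measure_addE.
(* Allowing any superset gives both the total mass and the mass of the segment. *)
have mu1 (A : set nat) : initial_segment n.+1 `<=` A -> mu A = 1%E.
  move=> nA; rewrite muE [X in (_ * X + _)%E]counting_block_sub => [|j jn].
    rewrite counting_block_sub => [|[]// _].
      by rewrite -!EFinM -EFinD mulr1 mulrC addrC subrK.
    by apply: nA; rewrite /initial_segment/= addn0.
  by apply: nA; rewrite /initial_segment/= add0n; exact: ltnW.
exists (probability_of_measure (mu1 setT (@subsetT _ _))).
split=> [|i /andP[i0 iln]]; first exact: mu1.
rewrite [LHS]muE !counting_block_set1 i0 add0n/= -ltnS iln.
by rewrite ltnNge -ltnS iln mule1 mule0 adde0.
Qed.

Lemma missing_mass_lower_bound_finite (R : realType) (n t : nat) :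
  (0 < n)%N -> (n < t)%N ->
  exists P : probability nat R,
    distribution_on (initial_segment n) P /\
    forall (d : measure_display) (Omega : measurableType d)
      (Pr : probability Omega R) (X : 'I_t -> {RV Pr >-> nat}),
    iid_sample P X ->
    ((4^-1 * ((n%:R - 1) / t%:R))%:E
      <= 'E_Pr[missing_mass (initial_segment n) P X])%E.
Proof.
case: n => // n _ nt.
have t0 : 0 < t%:R :> R by rewrite ltr0n; exact: leq_trans nt.
have t1 : 1 <= t%:R :> R by rewrite ler1n; exact: leq_trans nt.
have tnR : n.+1%:R <= t%:R :> R by rewrite ler_nat ltnW.
pose p : R := (2 * t%:R)^-1.
have tp : t%:R * p = 2^-1 by rewrite /p; field; rewrite gt_eqF.
have p0 : 0 <= p by rewrite /p invr_ge0 mulr_ge0.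
(* The equal atoms weigh at most [t * p], that is 1/2, because [n.+1 < t]. *)
have np1 : (n.+1%:R - 1) * p <= 1.
  by have := ler_wpM2r p0 tnR; rewrite tp; lra.
have [P [PS Pp]] := @near_uniform_distribution R n.+1 p isT p0 np1.
exists P; split=> // d Omega Pr X iidX.
(* The constant 1/4 combines the 1/2 in [p] with the 1/2 lower bound on the chance of missing an
   atom. *)
rewrite (_ : 4^-1 * _ = n%:R * p / 2); last first.
  by rewrite -[n.+1%:R]natr1 addrK /p; field; rewrite gt_eqF.
apply: (@le_expectation_missing_mass_half _ _ _ _ _ _ _ _ n
  (fun k : 'I_n => k.+1)) => //.
- by move=> j k [] /val_inj.
- by move=> k; rewrite /initial_segment/=; exact/ltnW/ltn_ord.
- by move=> k; apply: Pp; exact: ltn_ord.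
- by rewrite p0/=; have := ler_wpM2r p0 t1; lra.
- by rewrite tp.
Qed.

(** * Geometric levels and part (ii) *)

(* The geometric plateau distribution has [a] atoms of this mass at each level
   [k], namely at the points [k * a + 1, ..., k * a + a]. *)
Definition level_mass (R : realType) (a k : nat) : R :=
  1 / (2 ^ k.+1)%:R / a%:R.

Lemma level_massS (R : realType) (a k : nat) :
  level_mass R a k = 2 * level_mass R a k.+1.
Proof. by rewrite /level_mass (expnS 2 k.+1) natrM invfM; lra. Qed.

Lemma level_mass_ge0 (R : realType) (a k : nat) : 0 <= level_mass R a k.
Proof. by rewrite /level_mass !mulr_ge0. Qed.

Lemma level_mass_decreasing (R : realType) (a : nat) :
  {homo level_mass R a : j k / (j <= k)%N >-> k <= j}.
Proof.
apply: homo_leq => [x //|y x z|k]; first by move=> xy yz; exact: le_trans xy.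
by rewrite (level_massS R a k); have := level_mass_ge0 R a k.+1; lra.
Qed.

(** Level [k] weighs [2^-(k+1)] in all, and these weights sum to 1. The blocks partition the
    positive integers, so only block [i %/ a] charges the point [i.+1]. *)
Lemma geometric_plateau_distribution (R : realType) (a : nat) : (0 < a)%N ->
  exists P : probability nat R, distribution_on Nplus P /\
    forall i, P [set i.+1] = (level_mass R a (i %/ a))%:E.
Proof.
move=> a0.
have aR0 : a%:R != 0 :> R by rewrite pnatr_eq0 -lt0n.
pose mu : {measure set nat -> \bar R} := mseries (fun k =>
  mscale (NngNum (level_mass_ge0 R a k)) (counting_block R (k * a) a)) 0.
have muE A : mu A = (\sum_(0 <= k <oo)
    (level_mass R a k)%:E * counting_block R (k * a) a A)%E by [].
have mu1 (A : set nat) : Nplus `<=` A -> mu A = 1%E.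
  move=> posA; rewrite muE.
  rewrite (eq_eseriesr (g := fun k => (1 / (2 ^ (k + 1))%:R)%:E)); last first.
    move=> k _; rewrite counting_block_sub => [|j _]; last exact: posA.
    by rewrite -EFinM /level_mass addn1 divfK.
  have /cvg_lim-> // := @cvg_geometric_eseries_half R 1 0.
  by rewrite expr0 divr1.
exists (probability_of_measure (mu1 setT (@subsetT _ _))).
split=> [|i]; first exact: mu1.
rewrite [LHS]muE (@nneseriesD1 _ _ (i %/ a))// => [|k _]; last first.
  by rewrite mule_ge0// lee_fin level_mass_ge0.
have block k : (k * a < i.+1 <= k * a + a)%N = (k == i %/ a)%N.
  by rewrite -mulSnr ltnS -leq_divRL// -ltn_divLR// ltnS eqn_leq.
rewrite eseries0 => [|k _ /= /negPf ki]; last first.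
  by rewrite counting_block_set1 block ki mule0.
by rewrite adde0 counting_block_set1 block eqxx mule1.
Qed.
(** Masses halve at each step, so any level after one below [alpha] is already below [alpha / 2]. *)
Lemma level_inj (R : realType) (a j k : nat) (alpha : R) :
  alpha / 2 <= level_mass R a j < alpha ->
  alpha / 2 <= level_mass R a k < alpha -> j = k.
Proof.
wlog jk : j k / (j <= k)%N.
  move=> H jlev klev; have [/H->//|/ltnW kj] := leqP j k.
  by apply/esym/H.
move=> /andP[_ jlt] /andP[kge _]; apply/eqP; rewrite eqn_leq jk leqNgt/=.
apply/negP => /(level_mass_decreasing R a).
by rewrite level_massS in jlt => jk'; lra.
Qed.

(** For the upper bound, a nonempty window set lies inside a single level, which has [a] points. For
    the lower bound, one window captures all of level 0. *)
Lemma plateau_length_geometric (R : realType) (P : probability nat R)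
    (a : nat) :
  (1 < a)%N -> (forall i, P [set i.+1] = (level_mass R a (i %/ a))%:E) ->
  plateau_length P = a%:R%:E.
Proof.
move=> a1 PE; have a0 : (0 < a)%N by exact: ltnW.
pose plateau (alpha : R) :=
  [set i | Nplus i /\ ((alpha / 2)%:E <= P [set i] < alpha%:E)%E].
have plateauS alpha i : plateau alpha i.+1 <->
    alpha / 2 <= level_mass R a (i %/ a) < alpha.
  by rewrite /plateau /= PE lee_fin lte_fin; split=> [[]|].
have plateau_sub alpha k : alpha / 2 <= level_mass R a k < alpha ->
    plateau alpha `<=` (fun j => (k * a + j).+1) @` `I_a.
  move=> klev [[]//|i] /plateauS ilev.
  exists (i %% a)%N; first by rewrite /= ltn_mod.
  by rewrite -(level_inj ilev klev) -divn_eq.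
have card_plateau alpha : (plateau alpha #<= `I_a)%card.
  have [[[[]//|i] /plateauS ilev]|no] := pselect (exists i, plateau alpha i).
    apply: card_le_trans (card_image_le _ _).
    exact: subset_card_le (plateau_sub _ _ ilev).
  rewrite (_ : plateau alpha = set0) ?card_le0x//.
  by apply/seteqP; split=> // i ilev; apply: no; exists i.
have fin_plateau alpha : finite_set (plateau alpha).
  exact: card_le_finite (card_plateau alpha) (finite_II a).
have countingE alpha : counting (plateau alpha) =
    (#|` fset_set (plateau alpha)|)%:R%:E :> \bar R.
  by rewrite /counting asboolT.
apply/eqP; rewrite eq_le; apply/andP; split.
  apply: ge_ereal_sup => _ [alpha _ <-].
  by rewrite countingE lee_fin ler_nat geq_card_fset_set.
have aR : 1 < a%:R :> R by rewrite ltr1n.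
(* Level 0 has mass [1 / (2 * a)], the included left end of the window for [alpha = 1 / a]; [1 < a]
   makes this [alpha] less than 1. *)
apply: (@le_trans _ _ (counting (plateau a%:R^-1))); last first.
  apply: ereal_sup_ubound; exists a%:R^-1 => //=.
  by rewrite in_itv/= invr_gt0 invf_lt1 ?aR ?andbT; lra.
rewrite countingE lee_fin ler_nat leq_card_fset_set//.
have -> : (`I_a #<= plateau a%:R^-1)%card =
    (succn @` `I_a #<= plateau a%:R^-1)%card.
  by apply: card_le_eql; rewrite card_eq_sym; apply: inj_card_eq => ? ? _ _ [].
apply: subset_card_le => _ [j ja <-]; apply/plateauS.
rewrite divn_small// /level_mass expn1.
have : 0 < a%:R^-1 :> R by rewrite invr_gt0; lra.
by move=> ?; apply/andP; split; lra.
Qed.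

Lemma missing_mass_lower_bound_plateau (R : realType) (a : nat) :
  (1 < a)%N ->
  exists P : probability nat R,
    distribution_on Nplus P /\
    plateau_length P = (a%:R)%:E /\
    forall t : nat, (a < t)%N ->
    forall (d : measure_display) (Omega : measurableType d)
      (Pr : probability Omega R) (X : 'I_t -> {RV Pr >-> nat}),
    iid_sample P X ->
    ((8^-1 * (a%:R / t%:R))%:E <= 'E_Pr[missing_mass Nplus P X])%E.
Proof.
move=> a1; have a0 : (0 < a)%N by exact: ltnW.
have [P [PN PE]] := @geometric_plateau_distribution R a a0.
exists P; split=> //; split; first exact: plateau_length_geometric.
move=> t at_ d Omega Pr X iidX.
have ta0 : (0 < t %/ a)%N by rewrite divn_gt0// ltnW.
(* Rounding [t / a] to powers of two brackets [t] between [2 ^ k.-1 * a] and [2 ^ k * a]. *)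
pose k := (trunc_log 2 (t %/ a)).+1.
have [kt tk] : (2 ^ k.-1 * a <= t /\ t < 2 ^ k * a)%N.
  have /andP[lo hi] := trunc_log_bounds (isT : (1 < 2)%N) ta0.
  by rewrite -leq_divRL// -ltn_divLR.
have t1 : 1 <= t%:R :> R by rewrite ler1n; exact: leq_trans at_.
have aR0 : 0 < a%:R :> R by rewrite ltr0n.
have pk0 : 0 < (2 ^ k)%:R :> R by rewrite ltr0n expn_gt0.
(* Twice the level mass is the inverse of the upper bracket, which exceeds [t] but is at most
   [2 * t]. *)
have p2 : 2 * level_mass R a k = ((2 ^ k * a)%:R)^-1.
  by rewrite /level_mass expnS !natrM; field; rewrite !gt_eqF.
have p0 := level_mass_ge0 R a k.
have tp : t%:R * level_mass R a k <= 2^-1.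
  suff : t%:R * (2 * level_mass R a k) <= 1 by lra.
  by rewrite p2 ler_pdivrMr ?mul1r ?ler_nat ?(ltnW tk)// ltr0n muln_gt0
    expn_gt0.
apply: le_trans (@le_expectation_missing_mass_half _ _ _ _ _ _ _ _ a
  (fun j : 'I_a => (k * a + j).+1) _ iidX _ _ _ _ tp).
- rewrite lee_fin.
  (* The constant 1/8 is this 1/4 times the 1/2 in the bound [(2 * t)^-1] on twice the level
     mass. *)
  rewrite (_ : a%:R * _ / 2 = 4^-1 * a%:R * (2 * level_mass R a k)); last lra.
  suff : (2 * t%:R)^-1 <= 2 * level_mass R a k.
    rewrite invfM => /(ler_wpM2l (ltW aR0)); lra.
  rewrite p2 lef_pV2 ?posrE ?ltr0n ?muln_gt0 ?expn_gt0//; last by lra.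
  by rewrite -natrM ler_nat /k expnS -mulnA leq_mul2l.
- by move=> i j [] /addnI /val_inj.
- by [].
- by move=> j; rewrite PE divnMDl// divn_small ?addn0.
- by rewrite p0/=; have := ler_wpM2r p0 t1; lra.
Qed.

Theorem proposition3 (R : realType) :
  (exists c : R, 0 < c /\
    forall n t : nat, (0 < n)%N -> (n < t)%N ->
    exists P : probability nat R,
      distribution_on (initial_segment n) P /\
      forall (d : measure_display) (Omega : measurableType d)
        (Pr : probability Omega R) (X : 'I_t -> {RV Pr >-> nat}),
      iid_sample P X ->
      ((c * ((n%:R - 1) / t%:R))%:E
        <= 'E_Pr[missing_mass (initial_segment n) P X])%E) /\
  (exists c : R, 0 < c /\
    forall a : nat, (1 < a)%N ->
    exists P : probability nat R,
      distribution_on Nplus P /\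
      plateau_length P = (a%:R)%:E /\
      forall t : nat, (a < t)%N ->
      forall (d : measure_display) (Omega : measurableType d)
        (Pr : probability Omega R) (X : 'I_t -> {RV Pr >-> nat}),
      iid_sample P X ->
      ((c * (a%:R / t%:R))%:E <= 'E_Pr[missing_mass Nplus P X])%E).
Proof.
split.
  exists 4^-1; split=> // n t; exact: missing_mass_lower_bound_finite.
exists 8^-1; split=> // a; exact: missing_mass_lower_bound_plateau.
Qed.
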